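(* Let $\mathbf{A}\in\mathbb{Q}^{m\times n}$, let $r\le s\le l\le\min\{m,n\}$, let $\boldsymbol{\Omega}\in\mathbb{Q}^{n\times s}$ and $\boldsymbol{\Psi}\in\mathbb{Q}^{l\times m}$, and put $\mathbf{Y}=\mathbf{A}\boldsymbol{\Omega}$. Let $\mathbf{H}\in\mathbb{Q}^{m\times s}$ satisfy $\mathcal{R}(\mathbf{H})=\mathcal{R}(\mathbf{Y})$ and have full column rank, let $\mathbf{X}=(\boldsymbol{\Psi}\mathbf{H})^\dagger\boldsymbol{\Psi}\mathbf{A}\in\mathbb{Q}^{s\times n}$, and let $\lfloor\mathbf{X}\rfloor_r$ be the best rank-$r$ approximation of $\mathbf{X}$ given by its rank-$r$ truncated quaternion SVD. Then $$\|\mathbf{H}\lfloor\mathbf{X}\rfloor_r-\mathbf{H}\mathbf{X}\|_F\le\kappa(\mathbf{H})\left(\|\mathbf{A}-\mathbf{H}\mathbf{X}\|_F+\|\Sigma_2\|_F\right).$$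
   Context: $\mathbb{Q}$ denotes the real quaternions; for a quaternion matrix, $\mathcal{R}(\cdot)$ is the right linear span of the columns, $\|\cdot\|_F$ is the Frobenius norm, $^\dagger$ is the Moore-Penrose inverse. $\kappa(\mathbf{H})=\sigma_{\max}(\mathbf{H})/\sigma_{\min}(\mathbf{H})$, where $\sigma_{\max}(\mathbf{H})$ and $\sigma_{\min}(\mathbf{H})=\sigma_s(\mathbf{H})$ are the largest and the $s$-th singular value of $\mathbf{H}$. $\Sigma_2$ is the diagonal block of the quaternion SVD of $\mathbf{A}$ containing all singular values except the $r$ largest, i.e. $\|\Sigma_2\|_F=\left(\sum_{j>r}\sigma_j(\mathbf{A})^2\right)^{1/2}$ with $\sigma_1(\mathbf A)\ge\sigma_2(\mathbf A)\ge\cdots$ the singular values of $\mathbf{A}$. *)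

(* Defs.v *)
From HB Require Import structures.
From mathcomp Require Import all_boot all_order all_algebra.
From mathcomp Require Import ring.
From mathcomp Require Import classical_sets reals.

Set Implicit Arguments.
Unset Strict Implicit.
Unset Printing Implicit Defensive.

Import Order.TTheory GRing.Theory Num.Theory.
Local Open Scope ring_scope.

(* [Quat a b c d] is the quaternion a + b i + c j + d k. *)
Record quat (R : Type) : Type := Quat { q0 : R; q1 : R; q2 : R; q3 : R }.

Definition prod_of_quat (R : Type) (x : quat R) : R * R * R * R :=
  (q0 x, q1 x, q2 x, q3 x).
Definition quat_of_prod (R : Type) (t : R * R * R * R) : quat R :=
  let: (a, b, c, d) := t in Quat a b c d.

Lemma prod_of_quatK (R : Type) :
  cancel (@prod_of_quat R) (@quat_of_prod R).
Proof. by case. Qed.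

HB.instance Definition _ (R : eqType) :=
  Equality.copy (quat R) (can_type (@prod_of_quatK R)).
HB.instance Definition _ (R : choiceType) :=
  Choice.copy (quat R) (can_type (@prod_of_quatK R)).

Section QuatRing.
Variable R : comNzRingType.
Implicit Types x y z : quat R.

Definition quat_add x y :=
  Quat (q0 x + q0 y) (q1 x + q1 y) (q2 x + q2 y) (q3 x + q3 y).
Definition quat_opp x := Quat (- q0 x) (- q1 x) (- q2 x) (- q3 x).
Definition quat_zero : quat R := Quat 0 0 0 0.
Definition quat_one : quat R := Quat 1 0 0 0.
Definition quat_mul x y :=
  Quat (q0 x * q0 y - q1 x * q1 y - q2 x * q2 y - q3 x * q3 y)
       (q0 x * q1 y + q1 x * q0 y + q2 x * q3 y - q3 x * q2 y)
       (q0 x * q2 y - q1 x * q3 y + q2 x * q0 y + q3 x * q1 y)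
       (q0 x * q3 y + q1 x * q2 y - q2 x * q1 y + q3 x * q0 y).

Lemma quat_addA : associative quat_add.
Proof. by move=> [? ? ? ?] [? ? ? ?] [? ? ? ?]; rewrite /quat_add /= !addrA. Qed.
Lemma quat_addC : commutative quat_add.
Proof. by move=> [a b c d] [e f g h]; congr Quat; exact: addrC. Qed.
Lemma quat_add0 : left_id quat_zero quat_add.
Proof. by move=> [? ? ? ?]; rewrite /quat_add /= !add0r. Qed.
Lemma quat_addN : left_inverse quat_zero quat_opp quat_add.
Proof. by move=> [? ? ? ?]; rewrite /quat_add /= !addNr. Qed.

HB.instance Definition _ :=
  GRing.isZmodule.Build (quat R) quat_addA quat_addC quat_add0 quat_addN.

Lemma quat_mulA : associative quat_mul.
Proof. by move=> [? ? ? ?] [? ? ? ?] [? ? ? ?]; congr Quat => /=; ring. Qed.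
Lemma quat_mul1l : left_id quat_one quat_mul.
Proof. by move=> [? ? ? ?]; congr Quat => /=; ring. Qed.
Lemma quat_mul1r : right_id quat_one quat_mul.
Proof. by move=> [? ? ? ?]; congr Quat => /=; ring. Qed.
Lemma quat_mulDl : left_distributive quat_mul quat_add.
Proof. by move=> [? ? ? ?] [? ? ? ?] [? ? ? ?]; congr Quat => /=; ring. Qed.
Lemma quat_mulDr : right_distributive quat_mul quat_add.
Proof. by move=> [? ? ? ?] [? ? ? ?] [? ? ? ?]; congr Quat => /=; ring. Qed.
Lemma quat_one_neq0 : quat_one != quat_zero.
Proof. by apply/eqP => -[] /eqP; rewrite oner_eq0. Qed.

HB.instance Definition _ :=
  GRing.Zmodule_isNzRing.Build (quat R)
    quat_mulA quat_mul1l quat_mul1r quat_mulDl quat_mulDr quat_one_neq0.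

Definition quat_real (a : R) : quat R := Quat a 0 0 0.
Definition quat_conj x := Quat (q0 x) (- q1 x) (- q2 x) (- q3 x).

End QuatRing.

Definition quat_abs (R : realType) (x : quat R) : R :=
  Num.sqrt (q0 x ^+ 2 + q1 x ^+ 2 + q2 x ^+ 2 + q3 x ^+ 2).

Section QuatMatrix.
Variable R : realType.
Local Notation Q := (quat R).

Definition ctrmx m n (M : 'M[Q]_(m, n)) : 'M[Q]_(n, m) :=
  (map_mx (@quat_conj R) M)^T.

Definition frobenius m n (M : 'M[Q]_(m, n)) : R :=
  Num.sqrt (\sum_(i < m) \sum_(j < n) quat_abs (M i j) ^+ 2).

(* The scalars [x j 0] multiply the columns of [M] on the right, so this is
   the right linear span of the columns. *)
Definition col_space m n (M : 'M[Q]_(m, n)) : set 'cV[Q]_m :=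
  range (fun x : 'cV[Q]_n => M *m x).

(* Right linear independence of the columns. *)
Definition full_col_rank m n (M : 'M[Q]_(m, n)) : Prop :=
  forall x : 'cV[Q]_n, M *m x = 0 -> x = 0.

(* The four Penrose equations. *)
Definition is_pinv m n (M : 'M[Q]_(m, n)) (P : 'M[Q]_(n, m)) : Prop :=
  [/\ M *m P *m M = M,
      P *m M *m P = P,
      ctrmx (M *m P) = M *m P &
      ctrmx (P *m M) = P *m M].

Definition unitary n (U : 'M[Q]_n) : Prop :=
  ctrmx U *m U = 1%:M /\ U *m ctrmx U = 1%:M.

(* Rectangular diagonal matrix; entries beyond the length of [d] are 0. *)
Definition diag_rect m n (d : seq R) : 'M[Q]_(m, n) :=
  \matrix_(i < m, j < n) (if i == j :> nat then quat_real d`_i else 0).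

(* [M = U diag(d) V^*] is a quaternion SVD of [M]; [d`_j] is the (j+1)-st
   singular value. *)
Definition is_qsvd m n (M : 'M[Q]_(m, n))
    (U : 'M[Q]_m) (d : seq R) (V : 'M[Q]_n) : Prop :=
  [/\ unitary U, unitary V, size d = minn m n,
      sorted >=%R d /\ all (fun a => 0 <= a) d &
      M = U *m diag_rect m n d *m ctrmx V].

Definition singular_values m n (M : 'M[Q]_(m, n)) (d : seq R) : Prop :=
  exists U V, is_qsvd M U d V.

(* [d] is nonincreasing, so [take r d] keeps the [r] largest singular values;
   [diag_rect] pads with zeros. *)
Definition qsvd_trunc (r : nat) m n
    (U : 'M[Q]_m) (d : seq R) (V : 'M[Q]_n) : 'M[Q]_(m, n) :=
  U *m diag_rect m n (take r d) *m ctrmx V.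

(* For a matrix with [s] columns, sigma_min is its [s]-th singular value. *)
Definition kappa (s : nat) (d : seq R) : R := d`_0 / d`_s.-1.

(* Frobenius norm of the diagonal block left after removing the [r] largest
   singular values. *)
Definition tail_norm (r : nat) (d : seq R) : R :=
  Num.sqrt (\sum_(r <= j < size d) d`_j ^+ 2).

End QuatMatrix.

(* Main.v *)
(** Write [t_r M] for the tail norm of the singular values of [M].  Then
    [||H [X]_r - H X|| <= sigma_max(H) t_r X].  Let [G] be a left inverse of [H]
    of operator norm [1 / sigma_min(H)] and [A_r] the rank-[r] truncation of
    [A].  As [G A_r] has rank at most [r] and [X = G H X], Eckart-Young gives
    [t_r X <= ||X - G A_r|| <= ||H X - A_r|| / sigma_min(H)], and the triangle
    inequality through [A] concludes. *)

Require Import Defs.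
From HB Require Import structures.
From mathcomp Require Import all_boot all_order all_algebra.
From mathcomp Require Import ring.
From mathcomp Require Import classical_sets reals.

Set Implicit Arguments.
Unset Strict Implicit.
Unset Printing Implicit Defensive.

Import Order.TTheory GRing.Theory Num.Theory.
Local Open Scope ring_scope.

(** * Quaternion conjugation, real part and real scalars *)

Section QuatFacts.
Variable R : comNzRingType.
Implicit Types x y : quat R.

Lemma q0_is_zmod_morphism : zmod_morphism (@q0 R).
Proof. by []. Qed.

HB.instance Definition _ :=
  GRing.isZmodMorphism.Build (quat R) R (@q0 R) q0_is_zmod_morphism.

Lemma quat_conj_is_zmod_morphism : zmod_morphism (@quat_conj R).
Proof. by move=> x y; congr Quat => /=; rewrite opprD. Qed.

HB.instance Definition _ :=
  GRing.isZmodMorphism.Build (quat R) (quat R) (@quat_conj R)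
    quat_conj_is_zmod_morphism.

Lemma quat_conjM x y : quat_conj (x * y) = quat_conj y * quat_conj x.
Proof. by case: x y => [? ? ? ?] [? ? ? ?]; congr Quat => /=; ring. Qed.

Lemma quat_conjK : involutive (@quat_conj R).
Proof. by case=> [? ? ? ?]; congr Quat => /=; rewrite opprK. Qed.

Lemma quat_conj_real (a : R) : quat_conj (quat_real a) = quat_real a.
Proof. by congr Quat => /=; rewrite oppr0. Qed.

Lemma quat_real1 : quat_real 1 = 1 :> quat R.
Proof. by []. Qed.

Lemma quat_real_is_zmod_morphism : zmod_morphism (@quat_real R).
Proof. by move=> a b; congr Quat => /=; rewrite subr0. Qed.

HB.instance Definition _ :=
  GRing.isZmodMorphism.Build R (quat R) (@quat_real R)
    quat_real_is_zmod_morphism.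

Lemma quat_realM (a b : R) :
  quat_real (a * b) = quat_real a * quat_real b :> quat R.
Proof. by congr Quat => /=; ring. Qed.

Lemma q0_mulC x y : q0 (x * y) = q0 (y * x).
Proof. by case: x y => [? ? ? ?] [? ? ? ?] /=; ring. Qed.

Lemma q0_mul_real x a : q0 (x * quat_real a) = a * q0 x.
Proof. by case: x => [? ? ? ?] /=; ring. Qed.

Lemma q0_sum (I : Type) (r : seq I) (P : pred I) (F : I -> quat R) :
  q0 (\sum_(i <- r | P i) F i) = \sum_(i <- r | P i) q0 (F i).
Proof. exact: raddf_sum. Qed.

Lemma quat_conj_sum (I : Type) (r : seq I) (P : pred I) (F : I -> quat R) :
  quat_conj (\sum_(i <- r | P i) F i) = \sum_(i <- r | P i) quat_conj (F i).
Proof. exact: raddf_sum. Qed.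

End QuatFacts.

Lemma quat_conj_mul (R : realType) (x : quat R) :
  quat_conj x * x = quat_real (quat_abs x ^+ 2).
Proof.
rewrite /quat_abs sqr_sqrtr ?addr_ge0 ?sqr_ge0 //.
by case: x => [? ? ? ?]; congr Quat => /=; ring.
Qed.

(** * Conjugate transposes and rectangular diagonal matrices *)

Section QuatMatrixFacts.
Variable R : realType.
Local Notation Q := (quat R).

Lemma ctrmx_mul m n p (M : 'M[Q]_(m, n)) (N : 'M_(n, p)) :
  ctrmx (M *m N) = ctrmx N *m ctrmx M.
Proof.
apply/matrixP=> i j; rewrite !mxE quat_conj_sum; apply: eq_bigr => k _.
by rewrite !mxE quat_conjM.
Qed.

Lemma ctrmxK m n (M : 'M[Q]_(m, n)) : ctrmx (ctrmx M) = M.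
Proof. by apply/matrixP=> i j; rewrite !mxE quat_conjK. Qed.

Lemma ctrmxD m n (M N : 'M[Q]_(m, n)) : ctrmx (M + N) = ctrmx M + ctrmx N.
Proof. by apply/matrixP=> i j; rewrite !mxE raddfD. Qed.

Lemma ctrmxB m n (M N : 'M[Q]_(m, n)) : ctrmx (M - N) = ctrmx M - ctrmx N.
Proof. by apply/matrixP=> i j; rewrite !mxE raddfB. Qed.

Lemma ctrmx1 n : ctrmx 1%:M = 1%:M :> 'M[Q]_n.
Proof.
apply/matrixP=> i j; rewrite !mxE eq_sym -quat_real1.
by case: eqP => _; rewrite ?mulr1n ?mulr0n ?raddf0 ?quat_conj_real.
Qed.

(** Convertible to [diag_rect] when [f] is [nth 0 d]; a function in place of a list lets
    differences, products and inverses be taken pointwise. *)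
Definition diagf m n (f : nat -> R) : 'M[Q]_(m, n) :=
  \matrix_(i < m, j < n) (if i == j :> nat then quat_real (f i) else 0).

Lemma eq_diagf m n (f g : nat -> R) :
  (forall k, k < m -> k < n -> f k = g k)%N -> diagf m n f = diagf m n g.
Proof.
move=> fg; apply/matrixP=> i j; rewrite !mxE; case: eqP => // ij.
by rewrite fg // ij.
Qed.

Lemma diagf1 n : diagf n n (fun=> 1) = 1%:M.
Proof. by apply/matrixP=> i j; rewrite !mxE -val_eqE /=; case: eqP. Qed.

Lemma ctrmx_diagf m n f : ctrmx (diagf m n f) = diagf n m f.
Proof.
apply/matrixP=> i j; rewrite !mxE eq_sym; case: eqP => [->|_].
  exact: quat_conj_real.
exact: raddf0.
Qed.

Lemma diagfB m n f g :
  diagf m n f - diagf m n g = diagf m n (fun k => f k - g k).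
Proof.
apply/matrixP=> i j; rewrite !mxE; case: eqP => _; first by rewrite raddfB.
by rewrite subr0.
Qed.

(** The test [k < n] matters when the inner dimension is the smallest: it cuts the diagonal, which
    later realizes a truncation as a product. *)
Lemma mul_diagf m n p f g :
  diagf m n f *m diagf n p g =
  diagf m p (fun k => if (k < n)%N then f k * g k else 0).
Proof.
apply/matrixP=> i j; rewrite !mxE; case: (ltnP i n) => [lt_in|le_ni].
  rewrite (bigD1 (Ordinal lt_in)) //= !mxE eqxx big1 ?addr0.
    by case: eqP => _; rewrite ?quat_realM ?mulr0.
  move=> k; rewrite -val_eqE /= => neq_ki; rewrite !mxE eq_sym.
  by rewrite (negbTE neq_ki) mul0r.
rewrite big1 => [|k _]; first by case: ifP.
by rewrite !mxE gtn_eqF ?mul0r // (leq_trans (ltn_ord k)).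
Qed.

(** * The real trace and the Frobenius inner product *)

Definition retr n (M : 'M[Q]_n) : R := q0 (\tr M).

Lemma retrD n (M N : 'M[Q]_n) : retr (M + N) = retr M + retr N.
Proof. by rewrite /retr mxtraceD raddfD. Qed.

Lemma retrB n (M N : 'M[Q]_n) : retr (M - N) = retr M - retr N.
Proof. by rewrite /retr !raddfB. Qed.

Lemma retr_sum n (M : 'M[Q]_n) : retr M = \sum_i q0 (M i i).
Proof. exact: q0_sum. Qed.

(** Quaternions do not commute, so the trace itself is not cyclic; its real part is, because [x * y]
    and [y * x] have the same real part. *)
Lemma retr_mulC m n (M : 'M[Q]_(m, n)) (N : 'M_(n, m)) :
  retr (M *m N) = retr (N *m M).
Proof.
rewrite !retr_sum.
under eq_bigr do rewrite mxE q0_sum.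
under [RHS]eq_bigr do rewrite mxE q0_sum.
rewrite exchange_big /=; apply: eq_bigr => i _; apply: eq_bigr => j _.
exact: q0_mulC.
Qed.

Lemma retr_ctrmx n (M : 'M[Q]_n) : retr (ctrmx M) = retr M.
Proof. by rewrite !retr_sum; apply: eq_bigr => i _; rewrite !mxE. Qed.

Lemma retr_mul_diagf n (M : 'M[Q]_n) f :
  retr (M *m diagf n n f) = \sum_(i < n) f i * q0 (M i i).
Proof.
rewrite retr_sum; apply: eq_bigr => i _; rewrite -q0_mul_real; congr q0.
rewrite mxE (bigD1 i) //= mxE eqxx big1 ?addr0 // => k.
by rewrite -val_eqE => /negbTE neq_ki; rewrite mxE neq_ki mulr0.
Qed.

Definition fdot m n (M N : 'M[Q]_(m, n)) : R := retr (ctrmx M *m N).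
Definition fsq m n (M : 'M[Q]_(m, n)) : R := fdot M M.

Lemma fdotC m n (M N : 'M[Q]_(m, n)) : fdot M N = fdot N M.
Proof.
by rewrite /fdot -[RHS]retr_ctrmx ctrmx_mul ctrmxK.
Qed.

Lemma fsq_entries m n (M : 'M[Q]_(m, n)) :
  fsq M = \sum_(i < m) \sum_(j < n) quat_abs (M i j) ^+ 2.
Proof.
rewrite /fsq /fdot retr_sum exchange_big /=; apply: eq_bigr => j _.
by rewrite mxE q0_sum; apply: eq_bigr => i _; rewrite !mxE quat_conj_mul.
Qed.

Lemma fsq_ge0 m n (M : 'M[Q]_(m, n)) : 0 <= fsq M.
Proof. by rewrite fsq_entries; do 2!apply: sumr_ge0 => ? _; exact: sqr_ge0. Qed.

Lemma fsq_eq0 m n (M : 'M[Q]_(m, n)) : fsq M = 0 -> M = 0.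
Proof.
rewrite fsq_entries => /eqP; rewrite psumr_eq0 => [/allP M0|i _]; last first.
  by apply: sumr_ge0 => ? _; exact: sqr_ge0.
apply/matrixP=> i j; have := M0 i (mem_index_enum _); rewrite psumr_eq0 /=;
  last by move=> ? _; exact: sqr_ge0.
move=> /allP /(_ j (mem_index_enum _)) /=.
rewrite /quat_abs sqr_sqrtr ?addr_ge0 ?sqr_ge0 // mxE.
case: (M i j) => a b c d /=.
rewrite !paddr_eq0 ?addr_ge0 ?sqr_ge0 // !sqrf_eq0.
by move=> /andP[/andP[/andP[/eqP-> /eqP->] /eqP->] /eqP->].
Qed.

Lemma frobeniusE m n (M : 'M[Q]_(m, n)) : frobenius M = Num.sqrt (fsq M).
Proof. by rewrite fsq_entries. Qed.

Lemma fdotDl m n (M N L : 'M[Q]_(m, n)) : fdot (M + N) L = fdot M L + fdot N L.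
Proof. by rewrite /fdot ctrmxD mulmxDl retrD. Qed.

Lemma fdotBl m n (M N L : 'M[Q]_(m, n)) : fdot (M - N) L = fdot M L - fdot N L.
Proof. by rewrite /fdot ctrmxB mulmxBl retrB. Qed.

Lemma frobenius_sq m n (M : 'M[Q]_(m, n)) : frobenius M ^+ 2 = fsq M.
Proof. by rewrite frobeniusE sqr_sqrtr ?fsq_ge0. Qed.

Lemma fsqD m n (M N : 'M[Q]_(m, n)) :
  fsq (M + N) = fsq M + 2 * fdot M N + fsq N.
Proof.
rewrite /fsq fdotDl !(fdotC _ (M + N)) !fdotDl (fdotC N M).
by rewrite mulr_natl mulr2n !addrA.
Qed.

Lemma fsqB m n (M N : 'M[Q]_(m, n)) :
  fsq (M - N) = fsq M - 2 * fdot M N + fsq N.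
Proof.
rewrite /fsq fdotBl !(fdotC _ (M - N)) !fdotBl (fdotC N M).
by rewrite mulr_natl mulr2n !opprD opprK !addrA.
Qed.

Lemma fdot_scaler m n (M N : 'M[Q]_(m, n)) a :
  fdot M (N *m diagf n n (fun=> a)) = a * fdot M N.
Proof. by rewrite /fdot mulmxA retr_mul_diagf -mulr_sumr -retr_sum. Qed.

Lemma fsq_scaler m n (M : 'M[Q]_(m, n)) a :
  fsq (M *m diagf n n (fun=> a)) = a ^+ 2 * fsq M.
Proof. by rewrite /fsq fdot_scaler fdotC fdot_scaler mulrA. Qed.

(** Cauchy-Schwarz. With [a] and [c] the norms of [M] and [N], expanding the squared norm of
    [c M - a N] gives [0 <= 2 a c (a c - fdot M N)]; the case [a c = 0] is treated apart. *)
Lemma fdot_le m n (M N : 'M[Q]_(m, n)) :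
  fdot M N <= frobenius M * frobenius N.
Proof.
rewrite !frobeniusE.
have [a0|a_neq0] := eqVneq (fsq M) 0.
  rewrite a0 sqrtr0 mul0r (fsq_eq0 a0) /fdot.
  by rewrite (_ : ctrmx _ = 0) ?mul0mx /retr ?raddf0 // -(subrr 0) ctrmxB subrr.
have [c0|c_neq0] := eqVneq (fsq N) 0.
  by rewrite c0 sqrtr0 mulr0 (fsq_eq0 c0) /fdot mulmx0 /retr !raddf0.
set a := Num.sqrt (fsq M); set c := Num.sqrt (fsq N).
have ac_gt0 : 0 < a * c.
  by rewrite mulr_gt0 // sqrtr_gt0 lt0r ?a_neq0 ?c_neq0 fsq_ge0.
have := fsq_ge0 (M *m diagf n n (fun=> c) - N *m diagf n n (fun=> a)).
rewrite fsqB !fsq_scaler fdot_scaler fdotC fdot_scaler (fdotC N M).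
rewrite -[X in _ * X - _](sqr_sqrtr (fsq_ge0 M)).
rewrite -[X in _ + _ * X](sqr_sqrtr (fsq_ge0 N)) -/a -/c => h.
rewrite -subr_ge0 -(pmulr_rge0 _ ac_gt0) -(pmulr_rge0 _ (ltr0Sn R 1)).
by apply: le_trans h _; rewrite le_eqVlt; apply/orP; left; apply/eqP; ring.
Qed.

Lemma frobeniusD m n (M N : 'M[Q]_(m, n)) :
  frobenius (M + N) <= frobenius M + frobenius N.
Proof.
rewrite -(@ler_pXn2r _ 2) ?nnegrE ?addr_ge0 ?sqrtr_ge0 //.
rewrite sqrrD !frobenius_sq fsqD lerD2r lerD2l mulr_natl.
by rewrite lerMn2r fdot_le orbT.
Qed.

(** * Unitary invariance and operator norm bounds *)

Lemma fsq_ctrmx m n (M : 'M[Q]_(m, n)) : fsq (ctrmx M) = fsq M.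
Proof. by rewrite /fsq /fdot ctrmxK retr_mulC. Qed.

Lemma fsq_mul_isom m n p (U : 'M[Q]_(m, n)) (M : 'M_(n, p)) :
  ctrmx U *m U = 1%:M -> fsq (U *m M) = fsq M.
Proof.
by move=> UU; rewrite /fsq /fdot ctrmx_mul -mulmxA (mulmxA _ U) UU mul1mx.
Qed.

Lemma fsq_mul_ctr_isom m n p (V : 'M[Q]_(m, n)) (M : 'M_(p, n)) :
  ctrmx V *m V = 1%:M -> fsq (M *m ctrmx V) = fsq M.
Proof.
by move=> VV; rewrite -fsq_ctrmx ctrmx_mul ctrmxK fsq_mul_isom ?fsq_ctrmx.
Qed.

(** The weights on the right are the squared norms of the rows of [N]. *)
Lemma fsq_diagf_mul m n p f (N : 'M[Q]_(n, p)) :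
  fsq (diagf m n f *m N) =
  \sum_(k < n) (if (k < m)%N then f k ^+ 2 else 0) * q0 ((N *m ctrmx N) k k).
Proof.
rewrite /fsq /fdot ctrmx_mul ctrmx_diagf -mulmxA retr_mulC mulmxA mul_diagf.
by rewrite -mulmxA retr_mulC retr_mul_diagf.
Qed.

Lemma fsq_diagf m n f :
  fsq (diagf m n f) = \sum_(k < n) (if (k < m)%N then f k ^+ 2 else 0).
Proof.
rewrite -[diagf m n f]mulmx1 fsq_diagf_mul ctrmx1 mulmx1.
by apply: eq_bigr => k _; rewrite mxE eqxx mulr1.
Qed.

Lemma mul_ctrmx_diag_ge0 n p (N : 'M[Q]_(n, p)) i :
  0 <= q0 ((N *m ctrmx N) i i).
Proof.
rewrite mxE q0_sum sumr_ge0 // => j _; rewrite q0_mulC !mxE quat_conj_mul.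
exact: sqr_ge0.
Qed.

(** The factor [U] drops out, and [N] has the norm of [ctrmx V *m N]; both sides then become
    weighted sums of the same squared row norms, compared term by term. *)
Lemma frobenius_diagf_mul_le m n p (U : 'M[Q]_m) (V : 'M[Q]_n)
    (f : nat -> R) (c : R) (N : 'M_(n, p)) :
  unitary U -> unitary V ->
  (forall k, (k < m)%N -> (k < n)%N -> `|f k| <= c) ->
  0 <= c -> frobenius (U *m diagf m n f *m ctrmx V *m N) <= c * frobenius N.
Proof.
move=> [UU _] [_ VV] fc c_ge0.
rewrite -(@ler_pXn2r _ 2) ?nnegrE ?mulr_ge0 ?sqrtr_ge0 //.
rewrite exprMn !frobenius_sq -!mulmxA fsq_mul_isom //.
rewrite -(@fsq_mul_isom _ _ _ (ctrmx V) N) ?ctrmxK //.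
set L := ctrmx V *m N; rewrite fsq_diagf_mul /fsq /fdot retr_mulC retr_sum.
rewrite mulr_sumr; apply: ler_sum => k _.
rewrite ler_wpM2r ?mul_ctrmx_diag_ge0 //; case: ifP => [lt_km|_].
  by rewrite -real_normK ?num_real // ler_pXn2r ?nnegrE ?fc.
exact: sqr_ge0.
Qed.

(** * Orthogonal projectors and the Eckart-Young inequality *)

Lemma ctrmx_mul_cV m (c : 'cV[Q]_m) :
  ctrmx c *m c = diagf 1 1 (fun=> fsq c).
Proof.
apply/matrixP=> i j; rewrite !ord1 fsq_entries !mxE eqxx raddf_sum.
by apply: eq_bigr => k _; rewrite big_ord1 !mxE quat_conj_mul.
Qed.

(* Gram-Schmidt, one column at a time: a new column b with nonzero residual
   c = b - P b adds the rank-one projector c c^* / |c|^2. *)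
Lemma ortho_projector m r (K : 'M[Q]_(m, r)) :
  exists P : 'M[Q]_m,
    [/\ ctrmx P = P, P *m P = P, P *m K = K & retr P <= r%:R].
Proof.
elim: r K => [|r IHr] K.
  exists 0; split; rewrite ?mul0mx ?thinmx0 ?mulmx0 //.
    by rewrite -(subrr 0) ctrmxB !subrr.
  by rewrite /retr !raddf0.
have [P [PT PP PB trP]] := IHr (@rsubmx _ m 1 r K).
rewrite -[K](@hsubmxK _ m 1 r).
move: (@lsubmx _ m 1 r K) (@rsubmx _ m 1 r K) PB => b B PB.
pose c := b - P *m b.
have bE : b = c + P *m b by rewrite subrK.
have Pc : P *m c = 0 by rewrite mulmxBr mulmxA PP subrr.
clearbody c.
have [c0|c_neq0] := eqVneq c 0.
  exists P; split=> //; last by rewrite (le_trans trP) // ler_nat.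
  by rewrite (mul_mx_row P b B) PB [in RHS]bE c0 add0r.
have a_neq0 : fsq c != 0 by apply: contra_neq c_neq0 => /fsq_eq0.
(* The product [ctrmx c *m c] is the real scalar [fsq c], so it is inverted by a real 1 by 1
   matrix. *)
pose D := diagf 1 1 (fun=> (fsq c)^-1).
have DD : D *m (ctrmx c *m c) = 1%:M.
  rewrite ctrmx_mul_cV mul_diagf -diagf1; apply: eq_diagf => k lt_k _.
  by rewrite lt_k mulVf.
have cP : ctrmx c *m P = 0.
  rewrite -PT -ctrmx_mul Pc; apply/matrixP=> i j; rewrite !mxE.
  exact: raddf0.
pose E := c *m D *m ctrmx c.
have Ec : E *m c = c by rewrite -!mulmxA DD mulmx1.
have EP : E *m P = 0 by rewrite -mulmxA cP mulmx0.
have PE : P *m E = 0 by rewrite !mulmxA Pc !mul0mx.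
have ET : ctrmx E = E by rewrite !ctrmx_mul ctrmxK ctrmx_diagf mulmxA.
exists (P + E); split.
- by rewrite ctrmxD PT ET.
- by rewrite mulmxDl !mulmxDr PP PE EP addr0 add0r {2}/E !mulmxA Ec.
- have Pb : (P + E) *m b = b.
    rewrite [LHS](congr1 (mulmx (P + E)) bE) mulmxDl !mulmxDr Pc Ec !mulmxA.
    by rewrite PP EP mul0mx add0r addr0 addrC.
  have {}PB : (P + E) *m B = B.
    by rewrite mulmxDl -{2}PB mulmxA EP mul0mx addr0.
  by rewrite (mul_mx_row (P + E) b B) Pb PB.
(* By cyclicity [E] has the real trace of [D *m (ctrmx c *m c) = 1], so a new column adds at most
   one. *)
- rewrite retrD -natr1 lerD // /E -mulmxA retr_mulC -mulmxA DD retr_sum.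
  by rewrite big_ord1 mxE.
Qed.

(** Pythagoras: [M] is the sum of [(1%:M - P) *m M] and [P *m M], which are orthogonal. *)
Lemma fsq_proj_le m n (P : 'M[Q]_m) (M : 'M_(m, n)) :
  ctrmx P = P -> P *m P = P -> fsq ((1%:M - P) *m M) <= fsq M.
Proof.
move=> PT PP.
have SP : (1%:M - P) *m P = 0 by rewrite mulmxBl mul1mx PP subrr.
have {2}-> : M = (1%:M - P) *m M + P *m M.
  by rewrite -mulmxDl subrK mul1mx.
rewrite fsqD /fdot ctrmx_mul ctrmxB ctrmx1 PT -mulmxA (mulmxA (1%:M - P) P M).
rewrite SP mul0mx mulmx0 /retr !raddf0 mulr0 addr0.
by rewrite lerDl fsq_ge0.
Qed.

(** Since [P = P *m ctrmx P], the diagonal holds squared row norms. *)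
Lemma proj_diag_ge0 m (P : 'M[Q]_m) i :
  ctrmx P = P -> P *m P = P -> 0 <= q0 (P i i).
Proof. by move=> PT PP; rewrite -PP -{2}PT mul_ctrmx_diag_ge0. Qed.

(* Projecting orthogonally to the columns of [K] kills [K *m C], and turns
   [diagf m n f] into a matrix whose squared norm is the sum of the
   [f k ^+ 2] with weights in [0, 1] summing to at least [m - r]. *)
Lemma eckart_young m n r (f : nat -> R) (K : 'M[Q]_(m, r)) (C : 'M_(r, n)) :
  (r <= m)%N -> (m <= n)%N -> (forall k, 0 <= f k) ->
  (forall j k, (j <= k)%N -> f k <= f j) ->
  \sum_(k < m) (if (r <= k)%N then f k ^+ 2 else 0) <=
    fsq (diagf m n f - K *m C).
Proof.
move=> le_rm le_mn f_ge0 f_mono; have [P [PT PP PK trP]] := ortho_projector K.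
apply: le_trans (fsq_proj_le _ PT PP); set S := 1%:M - P.
have ST : ctrmx S = S by rewrite ctrmxB ctrmx1 PT.
have SS : S *m S = S.
  by rewrite mulmxBr mulmx1 mulmxBl mul1mx PP subrr subr0.
have SK : S *m K = 0 by rewrite mulmxBl PK mul1mx subrr.
rewrite mulmxBr (mulmxA S K C) SK mul0mx subr0.
rewrite /fsq /fdot ctrmx_mul ST -mulmxA (mulmxA S) SS retr_mulC -mulmxA.
rewrite ctrmx_diagf mul_diagf retr_mul_diagf -subr_ge0 -sumrB.
have Sii i : q0 (S i i) = 1 - q0 (P i i) by rewrite !mxE eqxx.
pose g k : R := (k < r)%:R.
(* Let [p] be the [k]-th diagonal entry of [P], in [0, 1]. The [k]-th term is [f k ^+ 2 * (1 - p)]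
   for [k < r] and [- f k ^+ 2 * p] otherwise; by monotonicity, [f r] in place of [f k] lowers it in
   both cases. What remains is that the real trace of [P] is at most [r], the sum of the [g k]. *)
suff: 0 <= \sum_(k < m) f r ^+ 2 * (g k - q0 (P k k)).
  move=> h; apply: le_trans h _; apply: ler_sum => k _.
  have P_ge0 := proj_diag_ge0 k PT PP.
  have := proj_diag_ge0 k ST SS; rewrite Sii => P_le1.
  rewrite (leq_trans (ltn_ord k) le_mn) /g; case: ltnP => [lt_kr|le_rk].
    rewrite subr0; apply: ler_wpM2r => //.
    by rewrite ler_pXn2r ?nnegrE ?f_mono // ltnW.
  rewrite -expr2 sub0r mulrBr mulr1 addrAC subrr sub0r mulrN lerN2.
  by rewrite ler_wpM2r // ler_pXn2r ?nnegrE ?f_mono.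
rewrite -mulr_sumr mulr_ge0 ?sqr_ge0 // sumrB -retr_sum subr_ge0.
apply: le_trans trP _; rewrite /g -natr_sum ler_nat.
rewrite -[leqLHS]card_ord -sum1_card (big_ord_widen m (fun=> 1%N)) //.
by rewrite big_mkcond; apply: leq_sum => k _; case: ifP.
Qed.

(** * Singular values, truncations and tails *)

Lemma sum_nat_window (r p n : nat) (F : nat -> R) : (p <= n)%N ->
  \sum_(r <= j < p) F j = \sum_(j < n) (if (r <= j < p)%N then F j else 0).
Proof.
move=> le_pn; rewrite (big_nat_widen r p n) // (big_nat_widenl r 0 n) //.
rewrite big_mkord big_mkcond; apply: eq_bigr => j _.
by rewrite andbC.
Qed.

(** Past the end of [d] the default 0 is read, which lies below all entries, so both properties hold
    for every index. *)
Lemma singular_values_mono (d : seq R) :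
  sorted >=%R d /\ all (fun a => 0 <= a) d ->
  (forall k, 0 <= d`_k) /\ (forall j k, (j <= k)%N -> d`_k <= d`_j).
Proof.
move=> [d_sorted /allP d_ge0].
have nth_ge0 k : 0 <= d`_k.
  have [le_k|lt_k] := leqP (size d) k; first by rewrite nth_default.
  by apply: d_ge0; rewrite mem_nth.
split=> // j k le_jk.
have [le_k|lt_k] := leqP (size d) k; first by rewrite [leLHS]nth_default.
have ge_trans : transitive (>=%R : rel R) by move=> x y z xy /le_trans; exact.
apply: (sorted_leq_nth ge_trans _ 0 d_sorted) => //; first exact: lexx.
exact: leq_ltn_trans le_jk lt_k.
Qed.

Lemma nth_take_if (d : seq R) r k :
  (take r d)`_k = if (k < r)%N then d`_k else 0.
Proof.
case: ltnP => [lt_kr|le_rk]; first by rewrite nth_take.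
by rewrite nth_default // size_take_min geq_min le_rk.
Qed.

Lemma frobenius_qsvd_trunc m n r (M : 'M[Q]_(m, n)) U d V :
  is_qsvd M U d V -> frobenius (qsvd_trunc r U d V - M) = tail_norm r d.
Proof.
move=> [[UU _] [VV _] sz_d _ ->]; rewrite /qsvd_trunc -mulmxBl -mulmxBr.
rewrite frobeniusE fsq_mul_ctr_isom // fsq_mul_isom //; congr Num.sqrt.
have -> : diag_rect m n (take r d) - diag_rect m n d =
    diagf m n (fun k => (take r d)`_k - d`_k) by rewrite -diagfB.
rewrite fsq_diagf sz_d (sum_nat_window _ _ (geq_minr m n)).
apply: eq_bigr => k _; rewrite nth_take_if leq_min ltn_ord andbT.
case: (ltnP k m) => _; rewrite ?andbF ?andbT //.
by case: ltnP => _; rewrite ?subrr ?expr0n // sub0r sqrrN.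
Qed.

Lemma frobenius_distC m n (M N : 'M[Q]_(m, n)) :
  frobenius (M - N) = frobenius (N - M).
Proof.
rewrite !frobeniusE !fsqB (fdotC M N) addrAC [in RHS]addrAC.
by rewrite (addrC (fsq M)).
Qed.

(** Rank at most [r] is encoded as a factorization [K *m C] through dimension [r]. This form
    survives moving [U] and [V] into the factors, which reduces to the diagonal case. *)
Lemma tail_norm_le m n r (X : 'M[Q]_(m, n)) U d V
    (K : 'M_(m, r)) (C : 'M_(r, n)) :
  (r <= m)%N -> (m <= n)%N -> is_qsvd X U d V ->
  tail_norm r d <= frobenius (X - K *m C).
Proof.
move=> le_rm le_mn [[UU UU'] [VV VV'] sz_d d_mono ->].
have [d_ge0 d_le] := singular_values_mono d_mono.
have -> : U *m diag_rect m n d *m ctrmx V - K *m C =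
    U *m (diagf m n (nth 0 d) - (ctrmx U *m K) *m (C *m V)) *m ctrmx V.
  rewrite mulmxBr mulmxBl; congr (_ - _).
  by rewrite !mulmxA UU' mul1mx -!mulmxA VV' mulmx1.
rewrite frobeniusE fsq_mul_ctr_isom // fsq_mul_isom // ler_sqrt ?fsq_ge0 //.
apply: le_trans (eckart_young (ctrmx U *m K) (C *m V) le_rm le_mn d_ge0 d_le).
rewrite sz_d (minn_idPl le_mn) (sum_nat_window _ _ (leqnn m)).
by apply: ler_sum => k _; rewrite ltn_ord andbT.
Qed.

(** If the last singular value vanished, [H] would kill the last column of [V], which is nonzero as
    [V] is unitary. *)
Lemma full_col_rank_sigma_gt0 m s (H : 'M[Q]_(m, s)) U d V :
  (0 < s)%N -> full_col_rank H -> is_qsvd H U d V -> 0 < d`_s.-1.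
Proof.
case: s H V => // s H V _ H_free.
move=> [UU [VV _] _ /singular_values_mono[d_ge0 _] defH].
rewrite lt0r d_ge0 andbT; apply/eqP => ds0.
pose e : 'cV[Q]_s.+1 := delta_mx ord_max 0.
have De0 : diag_rect m s.+1 d *m e = 0.
  apply/matrixP=> i j; rewrite !mxE big1 // => k _; rewrite !mxE ord1 andbT.
  have [->|_] := eqVneq k ord_max; last by rewrite mulr0.
  by rewrite mulr1; case: eqP => // ->; rewrite ds0.
have Ve0 : V *m e = 0.
  by apply: H_free; rewrite defH -!mulmxA (mulmxA _ V) VV mul1mx De0 mulmx0.
have e0 : e = 0 by rewrite -[e]mul1mx -VV -mulmxA Ve0 mulmx0.
have /matrixP/(_ ord_max 0) := e0; rewrite !mxE !eqxx.
by move/eqP; rewrite oner_eq0.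
Qed.

End QuatMatrixFacts.

(** * The truncation error bound *)

Theorem theorem4p2 (R : realType) (m n r s l : nat)
  (hrs : (r <= s)%N) (hsl : (s <= l)%N) (hl : (l <= minn m n)%N)
  (A : 'M[quat R]_(m, n))
  (Omega : 'M[quat R]_(n, s)) (Psi : 'M[quat R]_(l, m))
  (Y : 'M[quat R]_(m, s)) (hY : Y = A *m Omega)
  (H : 'M[quat R]_(m, s))
  (hHY : col_space H = col_space Y) (hH : full_col_rank H)
  (P : 'M[quat R]_(s, l)) (hP : is_pinv (Psi *m H) P)
  (X : 'M[quat R]_(s, n)) (hX : X = P *m Psi *m A)
  (U : 'M[quat R]_s) (sigmaX : seq R) (V : 'M[quat R]_n)
  (hXsvd : is_qsvd X U sigmaX V)
  (sigmaA : seq R) (hA : singular_values A sigmaA)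
  (sigmaH : seq R) (hsH : singular_values H sigmaH) :
  frobenius (H *m qsvd_trunc r U sigmaX V - H *m X) <=
    kappa s sigmaH * (frobenius (A - H *m X) + tail_norm r sigmaA).
Proof.
have [le_sm le_sn] : (s <= m)%N /\ (s <= n)%N.
  by move: (leq_trans hsl hl); rewrite leq_min => /andP[].
have [UA [VA svdA]] := hA; have [UH [VH svdH]] := hsH.
have [unUH unVH sz_H monoH defH] := svdH.
have [h_ge0 h_le] := singular_values_mono monoH.
have HT : frobenius (H *m qsvd_trunc r U sigmaX V - H *m X) <=
    sigmaH`_0 * tail_norm r sigmaX.
  rewrite -mulmxBr -(frobenius_qsvd_trunc r hXsvd) {1}defH.
  apply: frobenius_diagf_mul_le => // k _ _.
  by rewrite ger0_norm // h_le.
apply: le_trans HT _; rewrite /kappa -mulrA ler_wpM2l //.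
(* For [s = 0] there is no smallest singular value to divide by; the tail of [X] is then an empty
   sum and the bound reads [0 <= _]. *)
have [s0|s_gt0] := posnP s.
  rewrite /tail_norm; have [_ _ -> _ _] := hXsvd.
  rewrite (@big_geq _ _ _ r) ?sqrtr0; last by rewrite geq_min s0.
  by rewrite mulr_ge0 ?invr_ge0 ?addr_ge0 ?sqrtr_ge0.
have hs_gt0 := full_col_rank_sigma_gt0 s_gt0 hH svdH.
have h_gt0 k : (k < s)%N -> 0 < sigmaH`_k.
  move=> lt_ks; apply: lt_le_trans hs_gt0 (h_le _ _ _).
  by rewrite -ltnS (prednK s_gt0).
(* [G] is the pseudoinverse of [H] read off its SVD; it is a left inverse because all [s] singular
   values are positive. *)
pose g k := (sigmaH`_k)^-1.
pose G := VH *m diagf s m g *m ctrmx UH.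
have GH : G *m H = 1%:M.
  have [UU _] := unUH; have [_ VV'] := unVH.
  rewrite defH /G -!mulmxA (mulmxA (ctrmx UH)) UU mul1mx.
  rewrite (mulmxA (diagf _ _ _)) mul_diagf.
  rewrite (eq_diagf (g := fun=> 1)) ?diagf1 ?mul1mx // => k lt_ks _.
  by rewrite (leq_trans lt_ks le_sm) mulVf // gt_eqF ?h_gt0.
pose Ar := qsvd_trunc r UA sigmaA VA.
have Ar_fact : G *m Ar =
    (G *m UA *m diagf m r (fun=> 1)) *m (diagf r n (nth 0 sigmaA) *m ctrmx VA).
  rewrite /Ar /qsvd_trunc.
  (* The inner dimension [r] does the truncating, which exhibits [G *m Ar] as a product through
     dimension [r]. *)
  have -> : diag_rect m n (take r sigmaA) =
      diagf m r (fun=> 1) *m diagf r n (nth 0 sigmaA).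
    rewrite mul_diagf; apply: eq_diagf => k _ _.
    by rewrite nth_take_if mul1r.
  by rewrite !mulmxA.
have := tail_norm_le (G *m UA *m diagf m r (fun=> 1))
  (diagf r n (nth 0 sigmaA) *m ctrmx VA) hrs le_sn hXsvd.
rewrite -Ar_fact => /le_trans; apply.
have -> : X - G *m Ar = G *m (H *m X - Ar).
  by rewrite mulmxBr (mulmxA G H X) GH mul1mx.
(* Inversion reverses the order, so the smallest singular value of [H] bounds the operator norm of
   [G]. *)
have g_le k : (k < s)%N -> `|g k| <= (sigmaH`_s.-1)^-1.
  move=> lt_ks; rewrite ger0_norm ?invr_ge0 // lef_pV2 ?posrE ?h_gt0 //.
    by rewrite h_le // -ltnS (prednK s_gt0).
  by rewrite prednK.
apply: le_trans (frobenius_diagf_mul_le _ unVH unUH _ _) _.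
- by move=> k lt_ks _; exact: g_le.
- by rewrite invr_ge0.
rewrite ler_wpM2l ?invr_ge0 // -(frobenius_qsvd_trunc r svdA) -/Ar.
rewrite (frobenius_distC (H *m X) Ar) [leRHS]addrC.
have -> : Ar - H *m X = (Ar - A) + (A - H *m X) by rewrite addrA subrK.
exact: frobeniusD.
Qed.
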